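(* Let $\mathcal{I}$ be a meager ideal on $\omega$. Then $$\mathsf{Sub}_{\le\omega}\subseteq\mathscr{H}(\mathrm{Fin})\subseteq\mathscr{H}(\mathcal{I})\cap\mathscr{H}^\star(\mathcal{I}).$$ In particular, every characterized subgroup of $\mathbb{T}$ (that is, every element of $\mathscr{H}(\mathrm{Fin})$) is also $\mathcal{I}$-characterized (that is, an element of $\mathscr{H}(\mathcal{I})$).
   Context: $\omega=\{0,1,2,\dots\}$; $\mathbb{T}=\mathbb{R}/\mathbb{Z}$; $\|x\|:=\min\{|x-z|:z\in\mathbb{Z}\}$. $\mathrm{Fin}$ is the family of finite subsets of $\omega$. An ideal on $\omega$ is a family $\mathcal{I}\subseteq\mathcal{P}(\omega)$ closed under subsets and finite unions, with $\mathrm{Fin}\subseteq\mathcal{I}$ and $\omega\notin\mathcal{I}$; it is meager if it is a meager subset of $\mathcal{P}(\omega)$ identified with the Cantor space $2^\omega$. $\mathsf{Sub}_{\le\omega}$ is the family of countable subgroups of $\mathbb{T}$. A sequence $(x_n)$ in $\mathbb{T}$ is $\mathcal{I}$-convergent to $\eta$ if $\{n\in\omega:\|x_n-\eta\|\ge\varepsilon\}\in\mathcal{I}$ for all $\varepsilon>0$; it is $\mathcal{I}^\star$-convergent to $\eta$ if there is $S\in\mathcal{I}$ such that $(x_n:n\in\omega\setminus S)$ converges to $\eta$ in the ordinary sense. For $\boldsymbol{a}=(a_n:n\in\omega)\in\mathbb{Z}^\omega$, $\mathsf{H}_{\boldsymbol{a}}(\mathcal{I}):=\{x\in\mathbb{T}:\mathcal{I}\text{-}\lim_n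 a_nx=0\}$ and $\mathsf{H}^\star_{\boldsymbol{a}}(\mathcal{I}):=\{x\in\mathbb{T}:\mathcal{I}^\star\text{-}\lim_n a_nx=0\}$. Finally, $\mathscr{H}(\mathcal{I}):=\{\mathsf{H}_{\boldsymbol{a}}(\mathcal{I}):\boldsymbol{a}\in\mathbb{Z}^\omega\}$ and $\mathscr{H}^\star(\mathcal{I}):=\{\mathsf{H}^\star_{\boldsymbol{a}}(\mathcal{I}):\boldsymbol{a}\in\mathbb{Z}^\omega\}$. *)

(* Defs.v *)
From HB Require Import structures.
From mathcomp Require Import all_boot all_order all_algebra.
From mathcomp Require Import all_classical all_reals all_analysis.

Set Implicit Arguments.
Unset Strict Implicit.
Unset Printing Implicit Defensive.
Import Order.TTheory GRing.Theory Num.Theory.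
Import numFieldNormedType.Exports.

Local Open Scope classical_set_scope.
Local Open Scope ring_scope.
Local Open Scope quotient_scope.

(* The subgroup of integers of the additive group of R: [Num.int_num_subdef] is
   the predicate underlying [x \is a Num.int]. *)
Definition integers (R : realType) : zmodClosed R :=
  GRing.ZmodClosed.clone R (@Num.int_num_subdef R) _.

Definition circle (R : realType) : zmodType := Quotient.quot (integers R).

Definition circle_pi (R : realType) (x : R) : circle R :=
  \pi_(Quotient.quot (integers R)) x.

Definition circle_repr (R : realType) (x : circle R) : R :=
  repr (x : Quotient.quot (integers R)).

(* The infimum is a minimum and does not depend on the representative: see
   [circle_norm_min] below. *)
Definition circle_norm (R : realType) (x : circle R) : R :=
  inf [set `|circle_repr x - z%:~R| | z in [set: int]].

Lemma circle_reprK (R : realType) : cancel (@circle_repr R) (@circle_pi R).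
Proof. by move=> x; apply: reprK. Qed.

Lemma circle_pi_eq (R : realType) (x y : R) :
  circle_pi x = circle_pi y <-> exists z : int, x = y + z%:~R.
Proof.
have -> : (circle_pi x = circle_pi y) <-> (x - y \is a Num.int).
  by split=> [/eqP|xy]; [|apply/eqP]; rewrite -Quotient.idealrBE.
split=> [/intrP[z xy]|[z ->]]; first by exists z; rewrite -xy addrC subrK.
by rewrite addrC addKr intr_int.
Qed.

Lemma circle_piD (R : realType) (x y : R) :
  circle_pi (x + y) = circle_pi x + circle_pi y.
Proof. exact: raddfD. Qed.

Lemma circle_norm_min (R : realType) (x : R) :
  (exists z : int, circle_norm (circle_pi x) = `|x - z%:~R|) /\
  (forall z : int, circle_norm (circle_pi x) <= `|x - z%:~R|).
Proof.
set A := [set `|x - z%:~R| | z in [set: int]].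
have AE : circle_norm (circle_pi x) = inf A.
  have /circle_pi_eq[k rk] := circle_reprK (circle_pi x).
  congr inf; rewrite rk; apply/seteqP; split=> _ [z _ <-].
    by exists (z - k) => //; rewrite intrB opprB addrA.
  exists (z + k) => //; rewrite intrD; congr `|_|.
  by rewrite opprD addrACA subrr addr0.
have Alb : has_lbound A by exists 0 => _ [z _ <-].
have A0 : A !=set0 by exists `|x - 0%:~R|, 0.
rewrite AE; split=> [|z]; last by apply: ge_inf => //; exists z.
set f := Num.floor x.
have fx : 0 <= x - f%:~R by rewrite subr_ge0 Num.Theory.floor_le.
have xf : 0 <= (f + 1)%:~R - x by rewrite subr_ge0 ltW // floorD1_gt.
pose m := Num.min `|x - f%:~R| `|x - (f + 1)%:~R|.
suff -> : inf A = m.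
  by rewrite /m minEle; case: ifP => _; [exists f|exists (f + 1)].
apply/eqP; rewrite eq_le; apply/andP; split.
  apply: ge_inf => //.
  by rewrite /m minEle; case: ifP => _; [exists f|exists (f + 1)].
apply: lb_le_inf => // _ [z _ <-]; rewrite /m ge_min.
have [zf|zf] := leP z f; apply/orP; [left|right].
  rewrite (ger0_norm fx) (le_trans _ (ler_norm _)) // lerB //.
  by rewrite ler_int.
rewrite distrC (ger0_norm xf) distrC (le_trans _ (ler_norm _)) // lerB //.
by rewrite ler_int lezD1.
Qed.

Definition nowhere_dense (X : topologicalType) (A : set X) : Prop :=
  interior (closure A) = set0.

Definition meager (X : topologicalType) (A : set X) : Prop :=
  exists2 F : nat -> set X,
    (forall k, nowhere_dense (F k)) & A = \bigcup_k F k.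

Record is_ideal (I : set (set nat)) : Prop := IsIdeal {
  ideal_sub : forall A B : set nat, A `<=` B -> I B -> I A;
  ideal_setU : forall A B : set nat, I A -> I B -> I (A `|` B);
  ideal_fin : forall A : set nat, finite_set A -> I A;
  ideal_setT : ~ I [set: nat]
}.

Definition Fin : set (set nat) := [set A | finite_set A].

(* Subsets of nat are identified with their characteristic functions. *)
Definition meager_ideal (I : set (set nat)) : Prop :=
  is_ideal I /\ meager [set f : cantor_space | I [set n | f n = true]].

Definition ideal_cvg (R : realType) (I : set (set nat)) (x : nat -> circle R)
    (eta : circle R) : Prop :=
  forall e : R, 0 < e -> I [set n | e <= circle_norm (x n - eta)].

Definition ideal_star_cvg (R : realType) (I : set (set nat))
    (x : nat -> circle R) (eta : circle R) : Prop :=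
  exists2 S : set nat, I S &
    circle_norm (x n - eta) @[n --> within (~` S) \oo] --> (0 : R).

Definition H_ (R : realType) (a : nat -> int) (I : set (set nat)) :
    set (circle R) :=
  [set x | ideal_cvg I (fun n => x *~ a n) 0].
Arguments H_ : clear implicits.

Definition Hstar_ (R : realType) (a : nat -> int) (I : set (set nat)) :
    set (circle R) :=
  [set x | ideal_star_cvg I (fun n => x *~ a n) 0].
Arguments Hstar_ : clear implicits.

Definition scrH (R : realType) (I : set (set nat)) : set (set (circle R)) :=
  [set H_ R a I | a in [set: nat -> int]].
Arguments scrH : clear implicits.

Definition scrHstar (R : realType) (I : set (set nat)) :
    set (set (circle R)) :=
  [set Hstar_ R a I | a in [set: nat -> int]].
Arguments scrHstar : clear implicits.

Definition countable_subgroups (R : realType) : set (set (circle R)) :=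
  [set G | zmod_closed (mem G) /\ countable G].
Arguments countable_subgroups : clear implicits.

Definition characterized (R : realType) (G : set (circle R)) : Prop :=
  scrH R Fin G.

Definition ideal_characterized (R : realType) (I : set (set nat))
    (G : set (circle R)) : Prop :=
  scrH R I G.

(* Main.v *)
Require Import Defs.
From mathcomp Require Import all_boot all_order all_algebra.
From mathcomp Require Import all_classical all_reals all_analysis.
From mathcomp Require Import lra zify.

Set Implicit Arguments.
Unset Strict Implicit.
Unset Printing Implicit Defensive.
Import Order.TTheory GRing.Theory Num.Theory.
Import numFieldNormedType.Exports.

(** The two inclusions rest on two unrelated ideas.

    *** Countable subgroups are characterized.  Let the subgroup G be enumerated
    as h_0, h_1, ....  The natural candidates for the terms of a characterizing
    sequence are the elements of Bohr sets A = [bohr h p e], the m such that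
    ||m h_i|| <= e for all i < p.  Three facts about such a set A are used.

    - A has bounded gaps ([bohr_syndetic], by pigeonhole).  Hence a nonzero y
      close enough to 0 has a multiple m y, with m in A, at distance more than
      1/4 from 0: as m runs through A, the point m y moves in steps of length at
      most 1/4, so it cannot jump over the interval ]1/4, 1/2]
      ([bohr_detects_small]).
    - The polar K of A, the x such that ||m x|| <= 1/8 for all m in A, is
      contained in G.  This is Kronecker's approximation theorem; it is proved
      in [polar_bohr_subset] by averaging products of cosines over m.
      Moreover K is finite, since by the first fact distinct points of K are far
      from each other ([polar_bohr_finite]).
    - Finitely many elements of A already confine x to a given neighbourhood of K
      ([polar_approx], by compactness).

    Now take Bohr sets A_n with p -> oo and e -> 0, such that K_n is contained in
    {h_i : i < p_(n+1)}, and let B_n be a large finite part of A_n.  A sequence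
    that runs through all B_n tends to 0 at every h_i.  Conversely, let
    ||m x|| < 1/8 for all m in B_n, n >= N.  Then x is at distance at most eta_N
    from some c in K_N, and y = x - c satisfies ||m y|| <= 1/4 for all m in B_k,
    k > N, because c is one of the points that define A_k.  If eta_k is small with
    respect to the gaps of A_(k+1), the first fact improves ||y|| <= eta_k to
    ||y|| <= eta_(k+1).  So y = 0 and x = c is in G.

    *** From Fin to a meager ideal.  Following Jalali-Naini and Talagrand, a meager
    ideal I admits a finite-to-one phi : nat -> nat such that the preimage of an
    infinite set is never in I ([meager_ideal_finite_to_one]).  Repeating
    the terms of a sequence a along phi then turns ordinary convergence to 0 into
    I-convergence and into I*-convergence: H_a(Fin) = H_(a o phi)(I) =
    H*_(a o phi)(I). *)

Local Open Scope classical_set_scope.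
Local Open Scope ring_scope.

(** * The norm and the cosine on the circle *)

Lemma circle_norm_rep (R : realType) (x : circle R) :
  exists2 t : R, circle_pi t = x & circle_norm x = `|t|.
Proof.
have [[z xz] _] := circle_norm_min (circle_repr x).
rewrite circle_reprK in xz; exists (circle_repr x - z%:~R) => //.
rewrite -[RHS]circle_reprK; apply/circle_pi_eq; exists (- z).
by rewrite intrN.
Qed.

Lemma circle_norm_pi_le (R : realType) (t : R) : circle_norm (circle_pi t) <= `|t|.
Proof. by have := (circle_norm_min t).2 0; rewrite subr0. Qed.

Lemma circle_norm_pi_small (R : realType) (t : R) :
  `|t| <= 2^-1 -> circle_norm (circle_pi t) = `|t|.
Proof.
move=> t2; apply/eqP; rewrite eq_le circle_norm_pi_le /=.
have [[z ->] _] := circle_norm_min t.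
have [->|z0] := eqVneq z 0; first by rewrite subr0.
have : 1 <= `|z%:~R : R| by rewrite -intr_norm (ler_int R 1) -gtz0_ge1 normr_gt0.
have := ler_normB t (t - z%:~R); rewrite opprB addrC subrK; lra.
Qed.

Lemma circle_norm_ge0 (R : realType) (x : circle R) : 0 <= circle_norm x.
Proof. by have [t _ ->] := circle_norm_rep x. Qed.

Lemma circle_norm_le_half (R : realType) (x : circle R) : circle_norm x <= 2^-1.
Proof.
have [t <- xt] := circle_norm_rep x.
have := (circle_norm_min t).2 1; have := (circle_norm_min t).2 (-1).
rewrite xt intrN opprK mulr1z.
by have [?|?] := ger0P t; have [?|?] := ger0P (t + 1);
  have [?|?] := ger0P (t - 1); lra.
Qed.

Lemma circle_norm0 (R : realType) : circle_norm (0 : circle R) = 0.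
Proof.
have -> : (0 : circle R) = circle_pi 0 by rewrite /circle_pi raddf0.
by rewrite circle_norm_pi_small ?normr0 // invr_ge0.
Qed.

Lemma circle_norm_eq0 (R : realType) (x : circle R) : circle_norm x = 0 -> x = 0.
Proof.
have [t <- ->] := circle_norm_rep x.
by move=> /normr0P/eqP->; rewrite /circle_pi raddf0.
Qed.

Lemma circle_piN (R : realType) (t : R) : circle_pi (- t) = - circle_pi t.
Proof. exact: raddfN. Qed.

Lemma circle_piMn (R : realType) (t : R) m : circle_pi (t *+ m) = circle_pi t *+ m.
Proof. exact: raddfMn. Qed.

Lemma circle_normN (R : realType) (x : circle R) : circle_norm (- x) = circle_norm x.
Proof.
suff le y : circle_norm (- y) <= circle_norm y :> R.
  by apply/eqP; rewrite eq_le le -{1}(opprK x) le.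
have [t <- ->] := circle_norm_rep y.
by rewrite -circle_piN -normrN circle_norm_pi_le.
Qed.

Lemma circle_normD (R : realType) (x y : circle R) :
  circle_norm (x + y) <= circle_norm x + circle_norm y.
Proof.
have [t <- ->] := circle_norm_rep x; have [u <- ->] := circle_norm_rep y.
by rewrite -circle_piD (le_trans (circle_norm_pi_le _)) // ler_normD.
Qed.

Lemma circle_normB (R : realType) (x y : circle R) :
  circle_norm (x - y) <= circle_norm x + circle_norm y.
Proof. by rewrite (le_trans (circle_normD _ _)) // circle_normN. Qed.

Lemma circle_norm_triangle (R : realType) (x y : circle R) :
  circle_norm x <= circle_norm y + circle_norm (x - y).
Proof. by rewrite -{1}(subrK y x) addrC circle_normD. Qed.

(** Multiplication by m is exact as long as it does not wrap around the circle. *)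
Lemma circle_normMn_small (R : realType) (x : circle R) m :
  circle_norm x *+ m <= 2^-1 -> circle_norm (x *+ m) = circle_norm x *+ m.
Proof.
have [t <- ->] := circle_norm_rep x.
by rewrite -circle_piMn -normrMn => /circle_norm_pi_small.
Qed.

Lemma circle_normMn_le (R : realType) (x : circle R) m :
  circle_norm (x *+ m) <= circle_norm x *+ m.
Proof.
have [t <- ->] := circle_norm_rep x.
by rewrite -circle_piMn -normrMn circle_norm_pi_le.
Qed.

(** The real part of the character x |-> exp (2 i pi x) of the circle.  Complex
    exponentials can be avoided: products are linearized by d'Alembert's functional
    equation [ccosDB]. *)
Definition ccos (R : realType) (x : circle R) : R := cos (pi *+ 2 * circle_repr x).

Lemma ccos_pi (R : realType) (t : R) : ccos (circle_pi t) = cos (pi *+ 2 * t).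
Proof.
rewrite /ccos; have /circle_pi_eq[z ->] := circle_reprK (circle_pi t).
have cosn (u : R) (n : nat) : cos (u + pi *+ 2 * n%:R) = cos u.
  by rewrite mulr_natr; apply: periodicn; exact: cosD2pi.
rewrite mulrDr; case: z => n; first exact: cosn.
by rewrite NegzE intrN mulrN -[LHS](cosn _ n.+1) subrK.
Qed.

Lemma ccos0 (R : realType) : ccos (0 : circle R) = 1.
Proof.
have -> : (0 : circle R) = circle_pi 0 by rewrite /circle_pi raddf0.
by rewrite ccos_pi mulr0 cos0.
Qed.

Lemma ccosN (R : realType) (x : circle R) : ccos (- x) = ccos x.
Proof. by rewrite -(circle_reprK x) -circle_piN !ccos_pi mulrN cosN. Qed.

Lemma ccos_le1 (R : realType) (x : circle R) : ccos x <= 1.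
Proof. exact: cos_le1. Qed.

Lemma ccos_geN1 (R : realType) (x : circle R) : -1 <= ccos x.
Proof. exact: cos_geN1. Qed.

Lemma ccosDB (R : realType) (x y : circle R) :
  ccos (x + y) + ccos (x - y) = 2 * ccos x * ccos y.
Proof.
rewrite -(circle_reprK x) -(circle_reprK y) -circle_piN -!circle_piD !ccos_pi.
rewrite mulrDr mulrBr cosD cosB; lra.
Qed.

(** A representative nearest to 0 shows that [ccos] is a function of the norm; on the
    range [0, 1/2] of the norm this function is decreasing. *)
Lemma ccos_norm (R : realType) (x : circle R) :
  ccos x = cos (pi *+ 2 * circle_norm x).
Proof.
have [t <- ->] := circle_norm_rep x; rewrite ccos_pi -cos_norm normrM.
by rewrite (@ger0_norm _ (pi *+ 2)) // mulrn_wge0 ?pi_ge0.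
Qed.

Lemma ccos_le (R : realType) (x : circle R) (e : R) :
  0 <= e -> e <= circle_norm x -> ccos x <= cos (pi *+ 2 * e).
Proof.
move=> e0 ex; rewrite ccos_norm; have pi0 := @pi_gt0 R.
have pi2 : 0 < pi *+ 2 :> R by rewrite pmulrn_lgt0.
have := circle_norm_le_half x => x2.
have in0pi (u : R) : 0 <= u -> u <= 2^-1 -> pi *+ 2 * u \in `[0, pi].
  move=> u0 u2; rewrite in_itv /= mulr_ge0 ?(ltW pi2) //=.
  rewrite -[leRHS]mulr1 -mulr_natr -mulrA ler_pM2l //; lra.
have [->//|xe] := eqVneq e (circle_norm x).
rewrite ltW // ltr_cos; first by rewrite ltr_pM2l // lt_neqAle xe.
- by apply: in0pi => //; exact: le_trans x2.
- by apply: in0pi => //; exact: circle_norm_ge0.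
Qed.

Lemma cos_lt1_small (R : realType) (e : R) :
  0 < e -> e <= 2^-1 -> cos (pi *+ 2 * e) < 1.
Proof.
move=> e0 e2; have pi0 := @pi_gt0 R.
have pi2 : 0 < pi *+ 2 :> R by rewrite pmulrn_lgt0.
rewrite -[ltRHS](@cos0 R) ltr_cos ?mulr_gt0 // in_itv /= ?lexx ?(ltW pi0) //.
rewrite mulr_ge0 ?(ltW pi2) ?(ltW e0) //=.
rewrite -[leRHS]mulr1 -mulr_natr -mulrA ler_pM2l //; lra.
Qed.

Lemma ccos_lt1 (R : realType) (x : circle R) : x != 0 -> ccos x < 1.
Proof.
move=> x0; rewrite ccos_norm cos_lt1_small ?circle_norm_le_half //.
rewrite lt_neqAle circle_norm_ge0 andbT eq_sym.
by apply: contra x0 => /eqP /circle_norm_eq0 ->.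
Qed.

Lemma ccos_ge_half (R : realType) (x : circle R) :
  circle_norm x <= 8^-1 -> 2^-1 <= ccos x.
Proof.
move=> x8; rewrite ccos_norm; have pi0 := @pi_gt0 R; have x0 := circle_norm_ge0 x.
have cos8 : 2^-1 <= cos (pi *+ 2 * 8^-1 : R).
  (* c is the cosine of pi / 4, so 2 c ^ 2 = 1 by the duplication formula. *)
  set c := cos _.
  have : c ^+ 2 *+ 2 - 1 = 0.
    rewrite -cos_mulr2n -[RHS](@cos_pihalf R); congr cos.
    by move: (pi : R) => p; lra.
  have c0 : 0 <= c.
    by apply: cos_ge0_pihalf; move: (pi : R) pi0 => p p0; lra.
  nra.
apply: le_trans cos8 _.
rewrite -[leRHS]ccos_norm.
have -> : 8^-1 = circle_norm (circle_pi (8^-1 : R)).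
  by rewrite circle_norm_pi_small ger0_norm ?invr_ge0 //; lra.
rewrite -ccos_norm (ccos_norm x); apply: ccos_le => //.
by rewrite circle_norm_pi_small ger0_norm ?invr_ge0 //; lra.
Qed.

Lemma ccos_near0 (R : realType) (d : R) : 0 < d ->
  exists2 r : R, 0 < r & forall x : circle R, circle_norm x <= r -> 1 - d <= ccos x.
Proof.
move=> d0.
have : (cos (pi *+ 2 * t) @[t --> (0 : R)]) --> cos (pi *+ 2 * (0:R)).
  apply: continuous_cvg; first exact: continuous_cos.
  by apply: cvgM; [exact: cvg_cst|exact: cvg_id].
move=> /cvgrPdist_lt /(_ _ d0) /nbhs_ballP[r /= r0 rP].
exists (r / 2); first by rewrite divr_gt0.
move=> x xr; rewrite ccos_norm.
have /rP : ball (0 : R) r (circle_norm x).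
  rewrite /ball /= sub0r normrN ger0_norm ?circle_norm_ge0 //; lra.
by rewrite mulr0 cos0 => /ltr_normlW; lra.
Qed.

(** * Bohr sets and their gaps *)

(** Choose one occurrence of each of the finitely many values of f; L is the largest
    of these. *)
Lemma pigeonhole_bound (T : finType) (f : nat -> T) :
  exists L : nat, forall k, exists2 k', (k' <= L)%N & f k' = f k.
Proof.
have /choice[g gP] : forall t : T, exists k : nat, forall k', f k' = t -> f k = t.
  move=> t; have [[k fk]|nk] := pselect (exists k, f k = t); first by exists k.
  by exists 0%N => k' fk'; case: nk; exists k'.
exists (\max_t g t) => k; exists (g (f k)); last exact: gP.
exact: (leq_bigmax (f k)).
Qed.

Lemma circle_cells (R : realType) (e : R) : 0 < e ->
  exists K, exists cell : circle R -> 'I_K,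
    forall x y, cell x = cell y -> circle_norm (x - y) <= e.
Proof.
move=> e0; pose K := (Num.trunc e^-1).+1.
have eK : e^-1 <= K%:R by rewrite ltW // truncnS_gt.
pose fr (x : circle R) := circle_repr x - (Num.floor (circle_repr x))%:~R.
have fr01 x : 0 <= fr x < 1.
  by rewrite subr_ge0 Num.Theory.floor_le ltrBlDl /= -intrD1 floorD1_gt.
have frpi x : circle_pi (fr x) = x.
  rewrite -[RHS]circle_reprK; apply/circle_pi_eq.
  by exists (- Num.floor (circle_repr x)); rewrite intrN.
have cellP x : (Num.trunc (fr x * K%:R) < K)%N.
  have /andP[f0 f1] := fr01 x; rewrite -(ltr_nat R).
  apply: le_lt_trans (_ : fr x * K%:R < _).
    by rewrite truncn_le mulr_ge0.
  by rewrite -[ltRHS]mul1r ltr_pM2r // ltr0n.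
exists K, (fun x => Ordinal (cellP x)) => x y /(congr1 val) /= xy.
have le1 : `|fr x * K%:R - fr y * K%:R| <= 1.
  have /andP[x0 _] := fr01 x; have /andP[y0 _] := fr01 y.
  have := truncn_itv (mulr_ge0 x0 (ler0n R K)).
  have := truncn_itv (mulr_ge0 y0 (ler0n R K)).
  rewrite xy -natr1 => /andP[a b] /andP[c d].
  by rewrite ler_norml; lra.
rewrite -(frpi x) -(frpi y) -circle_piN -circle_piD.
apply: le_trans (circle_norm_pi_le _) _.
have K0 : 0 < K%:R :> R by rewrite ltr0n.
rewrite -(ler_pM2r K0) -{1}(ger0_norm (ltW K0)) -normrM mulrBl (le_trans le1) //.
by rewrite -(ler_pM2l (_ : 0 < e^-1)) ?invr_gt0 // mulr1 mulKf ?gt_eqF.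
Qed.

Definition bohr (R : realType) (h : nat -> circle R) (p : nat) (e : R) : set nat :=
  [set m | forall i, (i < p)%N -> circle_norm (h i *+ m) <= e].

(** Cut the torus of the points (h_i), i < p, into finitely many cells of size e.
    If m' <= L is such that m' h_i and M h_i lie in the same cells, then M - m' is
    in the Bohr set. *)
Lemma bohr_syndetic (R : realType) (h : nat -> circle R) p (e : R) : 0 < e ->
  exists L : nat, forall M, (L <= M)%N ->
    exists2 m, bohr h p e m & (M - L <= m <= M)%N.
Proof.
move=> e0; have [K [cell cellP]] := circle_cells e0.
pose f m : {ffun 'I_p -> 'I_K} := [ffun i => cell (h (val i) *+ m)].
have [L LP] := pigeonhole_bound f.
exists L => M LM; have [m' m'L fm] := LP M.
exists (M - m')%N; last by lia.
move=> i ip; rewrite mulrnBr; last by lia.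
by apply: cellP; have /ffunP/(_ (Ordinal ip)) := fm; rewrite !ffunE.
Qed.

(** With t = ||y||, any m of the interval ]1 / (4 t), 1 / (2 t)] makes m t larger than
    1/4 without wrapping around.  The interval is longer than the gaps of the Bohr
    set as soon as t (L + 1) <= 1/4.  The bound on m that comes with it allows to
    use only a finite part of the Bohr set. *)
Lemma bohr_detects_small (R : realType) (h : nat -> circle R) p (e : R) L :
  (forall M, (L <= M)%N -> exists2 m, bohr h p e m & (M - L <= m <= M)%N) ->
  forall y : circle R, y != 0 -> circle_norm y * L.+1%:R <= 4^-1 ->
  exists m, [/\ bohr h p e m, circle_norm y *+ m <= 2^-1
    & 4^-1 < circle_norm (y *+ m)].
Proof.
move=> LP y y0; set t := circle_norm y => tL.
have t0 : 0 < t.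
  rewrite lt_neqAle circle_norm_ge0 andbT eq_sym.
  by apply: contra y0 => /eqP /circle_norm_eq0 ->.
(* M is the last multiple of y before the antipode of 0; step back from it. *)
pose M := Num.trunc (2 * t)^-1.
have /andP[Mle Mgt] : M%:R <= (2 * t)^-1 < M.+1%:R.
  by rewrite truncn_itv // invr_ge0 mulr_ge0 // ltW.
have tt : t * (2 * t)^-1 = 2^-1.
  by rewrite invfM mulrCA mulfV ?mulr1 // gt_eqF.
have tM : t * M%:R <= 2^-1 by rewrite -tt ler_pM2l.
have tM1 : 2^-1 < t * M.+1%:R by rewrite -tt ltr_pM2l.
have LM : (L <= M)%N.
  rewrite -ltnS -(ltr_nat R) -(ltr_pM2l t0) (le_lt_trans _ tM1) //.
  by apply: le_trans (_ : t * L.+1%:R <= _); [rewrite ler_pM2l // ler_nat|lra].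
have [m mB /andP[Mm mM]] := LP M LM.
exists m; have tm : t *+ m <= 2^-1.
  by rewrite -[t *+ m]mulr_natr (le_trans _ tM) // ler_pM2l // ler_nat.
split=> //; rewrite circle_normMn_small // -/t -[t *+ m]mulr_natr.
have : t * M%:R <= t * (m%:R + L%:R).
  by rewrite -natrD ler_pM2l // ler_nat; lia.
move: tM1 tL; rewrite -(natr1 M) -(natr1 L) !mulrDr; lra.
Qed.

(** * Kronecker's theorem by averaging *)

Definition bounded_sums (R : realType) (u : nat -> R) : Prop :=
  exists B : R, forall N, `|\sum_(m < N) u m| <= B.

(** By the functional equation of [ccos], 2 (ccos x - 1) times the sum telescopes;
    the factor is nonzero because x is. *)
Lemma bounded_sums_ccos (R : realType) (x : circle R) : x != 0 ->
  bounded_sums (fun m => ccos (x *+ m)).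
Proof.
move=> /ccos_lt1; set c := ccos x => c1.
exists (4 / (2 * (1 - c))) => N.
have tele : 2 * (c - 1) * \sum_(m < N) ccos (x *+ m) =
    ccos (x *+ N) - ccos (x *+ N - x) - 1 + c.
  elim: N => [|N IH].
    rewrite big_ord0 mulr0 mulr0n ccos0 sub0r ccosN -/c; lra.
  rewrite big_ord_recr mulrDr IH (mulrSr x N) addrK.
  have := ccosDB (x *+ N) x; rewrite -/c; lra.
have c2 : 0 < 2 * (1 - c) by lra.
rewrite ler_pdivlMr // mulrC -[X in X * _](ger0_norm (ltW c2)) -normrM -normrN -mulNr.
rewrite -mulrN opprB tele.
have := ccos_le1 (x *+ N); have := ccos_geN1 (x *+ N).
have := ccos_le1 (x *+ N - x); have := ccos_geN1 (x *+ N - x).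
have := ccos_geN1 x; rewrite -/c => *; rewrite ler_norml; lra.
Qed.

Lemma bounded_sums_linear (R : realType) (a b : R) (u v : nat -> R) :
  bounded_sums u -> bounded_sums v -> bounded_sums (fun m => a * u m + b * v m).
Proof.
move=> [B BP] [C CP]; exists (`|a| * B + `|b| * C) => N.
rewrite big_split /= -!mulr_sumr (le_trans (ler_normD _ _)) // !normrM.
by rewrite lerD // ler_wpM2l ?BP ?CP.
Qed.

(** Products of cosines along G have their frequencies in G, so they have mean zero
    against a character of frequency outside G.  The property is phrased so as to
    be stable under multiplication by one more cosine, see [annihilatingM]. *)
Definition annihilating (R : realType) (G : set (circle R)) (w : nat -> R) :=
  forall x, ~ G x -> bounded_sums (fun m => w m * ccos (x *+ m)).

Lemma annihilating1 (R : realType) (G : set (circle R)) :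
  G 0 -> annihilating G (fun=> 1).
Proof.
move=> G0 x Gx; under eq_fun do rewrite mul1r.
by apply: bounded_sums_ccos; apply/eqP => x0; rewrite x0 in Gx.
Qed.

(** By the product formula for cosines, multiplying by ccos (m g) moves the
    frequency x to x + g and x - g, which are not in G either. *)
Lemma annihilatingM (R : realType) (G : set (circle R)) (g : circle R) w :
  zmod_closed (mem G) -> G g -> annihilating G w ->
  annihilating G (fun m => w m * ((1 + ccos (g *+ m)) / 2)).
Proof.
move=> [G0 GB] Gg wG x Gx.
have gG : g \in mem G by exact: mem_set.
have gN : - g \in mem G by rewrite -sub0r; exact: GB.
have Gp : ~ G (x + g).
  by move=> /mem_set xg; apply: Gx; rewrite -(addrK g x); exact/set_mem/GB.
have Gm : ~ G (x - g).
  move=> /mem_set xg; apply: Gx; rewrite -(subrK g x) -(opprK g).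
  by apply/set_mem/GB; rewrite ?opprK.
have [B BP] := bounded_sums_linear 1 (1 / 4)
  (bounded_sums_linear (1 / 2) (1 / 4) (wG _ Gx) (wG _ Gp)) (wG _ Gm).
exists B => N; have := BP N; congr (`|_| <= _); apply: eq_bigr => m _.
rewrite mulrnBl mulrnDl.
have := congr1 ( *%R (w m)) (ccosDB (x *+ m) (g *+ m)); lra.
Qed.

(** A trigonometric polynomial with values in [0, 1], which is close to 1 exactly when
    all m h_i are close to 0: its powers concentrate on Bohr sets. *)
Definition bohr_weight (R : realType) (h : nat -> circle R) (p m : nat) : R :=
  \prod_(i < p) ((1 + ccos (h i *+ m)) / 2).

Lemma bohr_factor_itv (R : realType) (y : circle R) : 0 <= (1 + ccos y) / 2 <= 1.
Proof. by have := ccos_le1 y; have := ccos_geN1 y; lra. Qed.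

Lemma bohr_weight_itv (R : realType) (h : nat -> circle R) p m :
  0 <= bohr_weight h p m <= 1.
Proof.
rewrite prodr_ge0 /=; last by move=> i _; have /andP[] := bohr_factor_itv (h i *+ m).
by rewrite prodr_ile1 // => i _; exact: bohr_factor_itv.
Qed.

Lemma bohr_weight_out (R : realType) (h : nat -> circle R) p (e : R) m :
  0 <= e -> ~ bohr h p e m ->
  bohr_weight h p m <= (1 + cos (pi *+ 2 * e)) / 2.
Proof.
move=> e0 /existsNP[i /not_implyP[ip /negP]]; rewrite -ltNge => hie.
rewrite /bohr_weight (bigD1 (Ordinal ip)) //=.
apply: le_trans (_ : (1 + ccos (h i *+ m)) / 2 <= _).
  rewrite ler_piMr //; first by have /andP[] := bohr_factor_itv (h i *+ m).
  by rewrite prodr_ile1 // => j _; exact: bohr_factor_itv.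
by have := ccos_le e0 (ltW hie); lra.
Qed.

Lemma bohr_weight_near1 (R : realType) (h : nat -> circle R) p (d : R) : 0 < d ->
  exists2 r : R, 0 < r & forall m, bohr h p r m -> 1 - d <= bohr_weight h p m.
Proof.
move=> d0; pose d' : R := d / p.+1%:R.
have d'0 : 0 < d' by rewrite divr_gt0 ?ltr0n.
have [r r0 rP] := ccos_near0 d'0; exists r => // m mB.
have Qn n : (n <= p)%N -> 1 - d' * n%:R <= bohr_weight h n m.
  rewrite /bohr_weight; elim: n => [|n IH] np; first by rewrite big_ord0 mulr0 subr0.
  rewrite big_ord_recr /=; set P := \prod_(i < n) _ in IH *.
  have P1 : P <= 1 by rewrite /P prodr_ile1 // => i _; exact: bohr_factor_itv.
  have := IH (ltnW np); have := rP _ (mB n np).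
  have /andP[] := bohr_factor_itv (h n *+ m).
  set f := (1 + _) / 2 => fge0 fle1 fd Pd; rewrite -natr1 mulrDr mulr1.
  have : (1 - P) * (1 - f) >= 0 by rewrite mulr_ge0 // subr_ge0.
  rewrite /f in fd *; lra.
apply: le_trans (Qn p (leqnn p)); rewrite lerD2l lerN2 /d'.
rewrite -mulrA ler_piMr ?(ltW d0) //.
by rewrite mulrC ler_pdivrMr ?ltr0n // mul1r ler_nat.
Qed.

(** Bounded gaps make the Bohr set meet each of J consecutive intervals of length
    L + 1, and each of these meetings contributes at least q ^ k. *)
Lemma bohr_weight_sum_ge (R : realType) (h : nat -> circle R) p (q : R) L :
  0 <= q ->
  (forall M, (L <= M)%N ->
    exists2 m, q <= bohr_weight h p m & (M - L <= m <= M)%N) ->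
  forall k J, q ^+ k * J%:R <= \sum_(m < J * L.+1) bohr_weight h p m ^+ k.
Proof.
move=> q0 LP k; elim=> [|J IH]; first by rewrite mulr0 mul0n big_ord0.
have [m mq /andP[m1 m2]] := LP (J * L.+1 + L)%N (leq_addl _ _).
have mlt : (m - J * L.+1 < L.+1)%N by lia.
rewrite mulSn addnC big_split_ord /= -natr1 mulrDr mulr1 lerD //.
rewrite (bigD1 (Ordinal mlt)) //= subnKC; last by lia.
rewrite -[leLHS]addr0 lerD //.
  by apply: lerXn2r => //; rewrite nnegrE // (le_trans q0).
apply: sumr_ge0 => i _; rewrite exprn_ge0 //.
by have /andP[] := bohr_weight_itv h p (J * L.+1 + i)%N.
Qed.

Lemma annihilating_prod (R : realType) (G : set (circle R)) (h : nat -> circle R)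
    (p k : nat) :
  zmod_closed (mem G) -> (forall i, G (h i)) ->
  annihilating G (fun m => bohr_weight h p m ^+ k).
Proof.
move=> Gz hG; elim: k => [|k IH].
  by apply: annihilating1; apply/set_mem; have [] := Gz.
suff: forall q, annihilating G (fun m => bohr_weight h p m ^+ k * bohr_weight h q m).
  by move=> /(_ p); under eq_fun do rewrite -exprSr.
elim=> [|q IHq].
  by under eq_fun do rewrite [X in _ * X]big_ord0 mulr1.
under eq_fun do rewrite [X in _ * X]big_ord_recr mulrA.
exact: annihilatingM.
Qed.

(** The constant 1/8 is small enough for the difference of two points of the polar
    to escape detection by [bohr_detects_small], and for [ccos_ge_half]. *)
Definition polar (R : realType) (A : set nat) : set (circle R) :=
  [set x | forall m, A m -> circle_norm (x *+ m) <= 8^-1].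
Arguments polar : clear implicits.

(** Kronecker's theorem: the polar of a Bohr set of points of G is contained in G.
    Let x be in the polar but not in G, and let Q = [bohr_weight h p].  On the Bohr
    set ccos (m x) >= 1/2, and off it 1 - Q is bounded below, so
    1/2 <= ccos (m x) + C (1 - Q m) for some C and all m.  Multiply by Q ^ k and
    sum over m < N: the cosine contributes a bounded amount, whence the means of the
    Q ^ k decrease at least like th ^ k, with th = 1 - 1 / (2 C).  But Q is at least
    q = 1 - 1 / (4 C) on a set with bounded gaps, so these means are at least
    q ^ k / (L + 1).  As q > th, this is absurd for large k. *)
Lemma polar_bohr_subset (R : realType) (G : set (circle R))
    (h : nat -> circle R) (p : nat) (e : R) :
  zmod_closed (mem G) -> (forall i, G (h i)) -> 0 < e ->
  polar R (bohr h p e) `<=` G.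
Proof.
(* The constant c below is surely positive only for e <= 1/2.  Decreasing e is
   harmless: it makes the Bohr set smaller and its polar larger. *)
move=> Gz hG; wlog e2 : e / e <= 2^-1.
  move=> H e0; apply: subset_trans (H (Num.min e 2^-1) _ _).
  - move=> x xP m mB; apply: xP => i ip; apply: le_trans (mB i ip) _.
    by rewrite ge_min lexx.
  - by rewrite ge_min lexx orbT.
  - by rewrite lt_min e0 /=; lra.
move=> e0 x xP; apply: contrapT => Gx.
pose Q := bohr_weight h p.
have Q01 m : 0 <= Q m <= 1 by exact: bohr_weight_itv.
pose c := (1 - cos (pi *+ 2 * e)) / 2.
have c0 : 0 < c by have := cos_lt1_small e0 e2; rewrite /c; lra.
pose C : R := 1 + 3 / 2 * c^-1.
have C1 : 1 <= C by rewrite /C lerDl mulr_ge0 ?invr_ge0 ?(ltW c0) // divr_ge0.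
have Cc : 3 / 2 <= C * c.
  have := mulVf (lt0r_neq0 c0); rewrite /C; move: (c^-1) => ci; lra.
have keyQ m : 2^-1 <= ccos (x *+ m) + C * (1 - Q m).
  have /andP[Q0 Q1] := Q01 m.
  have [mB|mB] := pselect (bohr h p e m).
    have := ccos_ge_half (xP m mB); have : 0 <= C * (1 - Q m); last by lra.
    by rewrite mulr_ge0 ?subr_ge0 // (le_trans _ C1).
  have Qc : Q m <= 1 - c by have := bohr_weight_out (ltW e0) mB; rewrite /c /Q; lra.
  have := ccos_geN1 (x *+ m).
  have : C * c <= C * (1 - Q m) by rewrite ler_pM2l; lra.
  lra.
pose th : R := 1 - (2 * C)^-1.
pose S k N := \sum_(m < N) Q m ^+ k.
have Cth : C * th = C - 2^-1.
  by rewrite /th mulrBr mulr1 invfM mulrCA mulfV ?mulr1 // gt_eqF // (lt_le_trans _ C1).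
have th2 : 2^-1 <= th.
  by rewrite -(ler_pM2l (lt_le_trans ltr01 C1)) Cth; lra.
have SS k : exists B : R, forall N, S k.+1 N <= th * S k N + B.
  have [B BP] := annihilating_prod p k Gz hG Gx.
  exists (C^-1 * B) => N.
  have Sk : 2^-1 * S k N <=
      (\sum_(m < N) Q m ^+ k * ccos (x *+ m)) + C * (S k N - S k.+1 N).
    rewrite /S -sumrB !mulr_sumr -big_split /=; apply: ler_sum => m _.
    have Qk : 0 <= Q m ^+ k by rewrite exprn_ge0 //; have /andP[] := Q01 m.
    have := ler_wpM2l Qk (keyQ m); rewrite exprS; lra.
  have C0 : 0 < C by lra.
  rewrite -(ler_pM2l C0) mulrDr !mulrA mulfV ?gt_eqF // mul1r Cth.
  have := le_trans (ler_norm _) (BP N); rewrite -/Q.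
  move: Sk; lra.
have Sth k : exists B : R, forall N, S k N <= th ^+ k * N%:R + B.
  elim: k => [|k [B BP]].
    by exists 0 => N; rewrite /S (eq_bigr (fun=> 1)) // sumr_const card_ord mul1r addr0.
  have [B' B'P] := SS k; exists (th * B + B') => N.
  apply: le_trans (B'P N) _; rewrite addrA lerD2r exprS -mulrA -mulrDr.
  by rewrite ler_pM2l //; lra.
pose q : R := 1 - (4 * C)^-1.
have d0 : 0 < (4 * C)^-1 by rewrite invr_gt0 mulr_gt0 //; lra.
have [r r0 rP] := bohr_weight_near1 h p d0.
have q0 : 0 <= q.
  by rewrite /q subr_ge0 invf_le1; lra.
have [L LP] := bohr_syndetic h p r0.
have Slow k J : q ^+ k * J%:R <= S k (J * L.+1)%N.
  apply: bohr_weight_sum_ge => // M /LP[m mB mM]; exists m => //; exact: rP.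
have qth k : q ^+ k <= th ^+ k * L.+1%:R.
  have [B BP] := Sth k; rewrite leNgt; apply/negP => lt.
  set dd := q ^+ k - th ^+ k * L.+1%:R.
  have dd0 : 0 < dd by rewrite subr_gt0.
  pose J := (Num.trunc (`|B| / dd)).+1.
  have JB : B < J%:R * dd.
    rewrite -ltr_pdivrMr // (le_lt_trans _ (truncnS_gt _)) //.
    by rewrite ler_pM2r ?invr_gt0 ?ler_norm.
  have := le_trans (Slow k J) (BP _); rewrite natrM.
  by move: JB; rewrite /dd; lra.
have th0 : 0 < th by lra.
pose g := q / th - 1.
have g0 : 0 < g.
  rewrite subr_gt0 ltr_pdivlMr // mul1r /q /th ltrD2l ltrN2 ltf_pV2 ?posrE; lra.
have bern k : 1 + k%:R * g <= (1 + g) ^+ k.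
  elim: k => [|k IH]; first by rewrite mul0r addr0.
  rewrite exprSr -natr1 mulrDl mul1r.
  have : 0 <= k%:R * g * g by rewrite !mulr_ge0 // ltW.
  have : (1 + k%:R * g) * (1 + g) <= (1 + g) ^+ k * (1 + g) by rewrite ler_pM2r //; lra.
  lra.
pose k := (Num.trunc (L.+1%:R / g)).+1.
have kL : L.+1%:R < k%:R * g by rewrite -ltr_pdivrMr // truncnS_gt.
have := qth k; rewrite -ler_pdivrMl ?exprn_gt0 // mulrC -expr_div_n.
have -> : q / th = 1 + g by rewrite /g addrC subrK.
have := bern k; lra.
Qed.

(** * Countable subgroups are characterized *)

(** If no M works, then there are points x_M, at distance more than eta from the polar,
    that belong to the polar of the part of A below M.  Any cluster point of the x_M
    is in the polar of A, a contradiction.  The points are lifted to [-1/2, 1/2] to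
    use the compactness of a segment. *)
Lemma polar_approx (R : realType) (A : set nat) (eta : R) : 0 < eta ->
  exists M : nat, forall x : circle R,
    polar R (A `&` [set m | (m <= M)%N]) x ->
    exists2 c, polar R A c & circle_norm (x - c) <= eta.
Proof.
move=> eta0; apply: contrapT => noM.
have /choice[t tP] M : exists t : R, [/\ t \in `[(- 2^-1), 2^-1],
    polar R (A `&` [set m | (m <= M)%N]) (circle_pi t) &
    forall c, polar R A c -> eta < circle_norm (circle_pi t - c)].
  apply: contrapT => not; apply: noM; exists M => x xP.
  apply: contrapT => noc; apply: not.
  have [t tx nx] := circle_norm_rep x; exists t; split.
  - have := circle_norm_le_half x; rewrite nx in_itv /= ler_norml; lra.
  - by rewrite tx.
  - by move=> c cP; rewrite tx ltNge; apply/negP => xc; apply: noc; exists c.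
have [|u [_ uP]] := @segment_compact R (- 2^-1) 2^-1 (t @ \oo) _.
  by exists 0%N => // M _; have [] := tP M.
have near M (r : R) : 0 < r -> exists2 M', (M <= M')%N & `|u - t M'| < r.
  move=> r0; have [||v [[M' MM' <-] Bv]] := uP (t @` [set M' | (M <= M')%N]) (ball u r).
  - by exists M => // M' MM'; exists M'.
  - exact: nbhsx_ballx.
  by exists M'.
have uK : polar R A (circle_pi u).
  move=> m Am; apply/ler_addgt0Pl => r r0.
  have [M' mM' uM'] := near m (r / m.+1%:R) (divr_gt0 r0 (ltr0Sn _ _)).
  have [_ /(_ m (conj Am mM')) tm _] := tP M'.
  apply: le_trans (circle_norm_triangle _ (circle_pi (t M') *+ m)) _.
  rewrite addrC lerD // -mulrnBl -circle_piN -circle_piD.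
  apply: le_trans (circle_normMn_le _ _) _.
  apply: le_trans (ler_wMn2r m (circle_norm_pi_le _)) _.
  rewrite -mulr_natr; apply: le_trans (_ : r / m.+1%:R * m%:R <= _).
    by rewrite ler_wpM2r // ltW.
  by rewrite -mulrA ler_piMr ?(ltW r0) // mulrC ler_pdivrMr ?ltr0n // mul1r ler_nat.
have [M' _ uM'] := near 0%N eta eta0.
have [_ _ /(_ _ uK)] := tP M'.
rewrite -circle_piN -circle_piD ltNge (le_trans (circle_norm_pi_le _)) //.
by rewrite distrC ltW.
Qed.

(** Two points of the polar that lie in the same small cell are equal: the norm of the
    multiples of their difference by elements of the Bohr set is at most 1/8 + 1/8, so
    [bohr_detects_small] forbids a small nonzero difference.  Recording, together
    with the cell of h_i, whether h_i is in the polar makes the representative given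
    by the pigeonhole principle a point of the polar. *)
Lemma polar_bohr_finite (R : realType) (h : nat -> circle R) p (e : R) :
  0 < e -> zmod_closed (mem (range h)) ->
  exists p', forall x, polar R (bohr h p e) x -> exists2 i, (i < p')%N & h i = x.
Proof.
move=> e0 hG.
have [L LP] := bohr_syndetic h p e0.
have detect := bohr_detects_small LP.
have d0 : 0 < 4^-1 / L.+1%:R :> R by rewrite divr_gt0 ?ltr0n // invr_gt0.
have [K [cell cellP]] := circle_cells d0.
have [p' p'P] := pigeonhole_bound
  (fun i => (cell (h i), `[< polar R (bohr h p e) (h i) >])).
exists p'.+1 => x xK.
have hR i : range h (h i) by exists i.
have [k _ kx] := polar_bohr_subset hG hR e0 xK.
have [i ip [ixcell]] := p'P k; rewrite kx (asboolT xK) => /asboolP iK.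
exists i => //; rewrite kx in ixcell.
apply/eqP; rewrite -subr_eq0; apply/negPn/negP => y0.
have := cellP _ _ ixcell; rewrite ler_pdivlMr ?ltr0n // => small.
have [m [mB _]] := detect _ y0 small.
rewrite mulrnBl ltNge (le_trans (circle_normB _ _)) //.
have := iK m mB; have := xK m mB; lra.
Qed.

Lemma countable_range (T : Type) (G : set T) (x0 : T) : G x0 -> countable G ->
  exists h : nat -> T, range h = G.
Proof.
move=> Gx0 /countable_injP[f finj].
have /choice[h hP] k : exists x, G x /\ forall y, G y -> f y = k -> x = y.
  have [[x Gx fx]|nx] := pselect (exists2 x, G x & f x = k).
    exists x; split=> // y Gy fy; apply: finj; rewrite ?inE //.
    by rewrite fx fy.
  by exists x0; split=> // y Gy fy; case: nx; exists y.
exists h; apply/seteqP; split=> [_ [k _ <-]|x Gx]; first by have [] := hP k.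
by exists (f x) => //; apply: (hP (f x)).2.
Qed.

(** A sequence that runs through the elements of all B_n: the terms are indexed by the
    pairs (n, m), and a pair with m not in B_n yields the harmless value 0. *)
Definition block_seq (B : nat -> set nat) (k : nat) : int :=
  if pickle_inv k is Some (n, m) then (if `[< B n m >] then m%:Z else 0) else 0.

Lemma finite_set_bounded (A : set nat) : finite_set A ->
  exists N, forall n, A n -> (n < N)%N.
Proof.
move=> /finite_seqP[s ->]; exists (\max_(n <- s) n).+1 => n /= ns.
by rewrite ltnS; apply: (@leq_bigmax_seq _ s predT id n).
Qed.

Lemma H_block_seq (R : realType) (B : nat -> set nat) (x : circle R) :
  (forall n, finite_set (B n)) ->
  H_ R (block_seq B) Fin x <->
  forall e, 0 < e -> exists N, forall n m, (N <= n)%N -> B n m ->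
    circle_norm (x *+ m) < e.
Proof.
move=> Bfin; split=> [xH e e0|xB e e0].
  pose block k := if @pickle_inv (nat * nat)%type k is Some (n, _) then n else 0%N.
  have /(finite_image block)/finite_set_bounded[N NP] := xH e e0.
  exists N => n m Nn nm; rewrite ltNge; apply/negP => em; move: Nn; rewrite leqNgt NP //.
  exists (pickle (n, m)); last by rewrite /block pickleK_inv.
  by rewrite /= subr0 /block_seq pickleK_inv asboolT.
have [N NP] := xB e e0.
apply: (@sub_finite_set _ _ (\bigcup_(n in `I_N) ((fun m => pickle (n, m)) @` B n))).
  move=> k /=; rewrite subr0 /block_seq.
  have := @pickle_invK (nat * nat)%type k.
  case: pickle_inv => [[n m] /= <-|_]; last first.
    by rewrite mulr0z circle_norm0 leNgt e0.
  case: asboolP => [nm ex|_]; last by rewrite mulr0z circle_norm0 leNgt e0.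
  exists n; last by exists m.
  by rewrite /= ltnNge; apply/negP => /NP/(_ nm); rewrite ltNge ex.
by apply: bigcup_finite => [|n _]; [exact: finite_II|exact: finite_image].
Qed.

(** The theorem of Biro, Deshouillers and Sos. *)
Lemma countable_subgroup_characterized (R : realType) (G : set (circle R)) :
  countable_subgroups R G -> scrH R Fin G.
Proof.
move=> [Gz Gc].
have G0 : G 0 by apply/set_mem; have [] := Gz.
have [h hG] := countable_range G0 Gc.
have hz : zmod_closed (mem (range h)) by rewrite hG.
pose e n : R := 8^-1 / n.+1%:R.
have e0 n : 0 < e n by rewrite divr_gt0 ?ltr0n // invr_gt0.
have e8 n : e n <= 8^-1.
  by rewrite /e ler_pdivrMr ?ltr0n // ler_peMr ?invr_ge0 // ler1n.
have /choice[nextp nextpP] (np : nat * nat) : exists p',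
    forall x, polar R (bohr h np.2 (e np.1)) x -> exists2 i, (i < p')%N & h i = x.
  exact: polar_bohr_finite.
(* p (n + 1) is taken so large that the polar of A_n lies in {h_i : i < p (n + 1)};
   it is also strictly increasing, so that every h_i is eventually taken into account. *)
pose p := fix p n := if n is n'.+1 then maxn (p n').+1 (nextp (n', p n')) else 0%N.
have p_mono : {homo p : i j / (i <= j)%N}.
  apply: homo_leq => //; first exact: leq_trans.
  by move=> n; rewrite /= leq_max leqnSn.
have p_ge n : (n <= p n)%N by elim: n => //= n IH; rewrite leq_max ltnS IH.
pose A n := bohr h (p n) (e n).
have polarA n x : polar R (A n) x -> exists2 i, (i < p n.+1)%N & h i = x.
  move=> /(nextpP (n, p n))[i ip hi]; exists i => //.
  by rewrite /= leq_max ip orbT.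
have /choice[L LP] n := bohr_syndetic h (p n) (e0 n).
(* eta_n must satisfy the smallness condition of bohr_detects_small for the gaps of
   the next Bohr set, and tend to 0. *)
pose eta n : R := 4^-1 / (L n.+1).+1%:R / n.+1%:R.
have eta0 n : 0 < eta n by rewrite !divr_gt0 ?ltr0n // invr_gt0.
have etaL n : eta n * (L n.+1).+1%:R <= 4^-1.
  rewrite /eta mulrAC divfK ?pnatr_eq0 //.
  by rewrite ler_pdivrMr ?ltr0n // ler_peMr ?invr_ge0 // ler1n.
have eta_small (y : circle R) N :
    (forall k, (N <= k)%N -> circle_norm y <= eta k) -> y = 0.
  move=> yk; apply: circle_norm_eq0; apply/eqP; rewrite eq_le circle_norm_ge0 andbT.
  apply/ler_addgt0Pl => r r0; rewrite addr0.
  pose k := maxn N (Num.trunc r^-1); apply: le_trans (yk k (leq_maxl _ _)) _.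
  have kr : r^-1 <= k.+1%:R.
    by rewrite (le_trans (ltW (truncnS_gt _))) // ler_nat ltnS leq_maxr.
  rewrite /eta ler_pdivrMr ?ltr0n // (@le_trans _ _ 1) //.
    rewrite ler_pdivrMr ?ltr0n // mul1r (@le_trans _ _ 1) ?ler1n //; lra.
  by rewrite -(ler_pM2l r0) mulfV ?gt_eqF // in kr.
have /choice[M0 M0P] n := polar_approx (A n) (eta0 n).
(* The second bound on M_n ensures that B_n detects every nonzero y that A_n detects
   and that has norm at least eta_n. *)
pose M n := maxn (M0 n) (Num.trunc (2 * eta n)^-1).+1.
pose B n := A n `&` [set m | (m <= M n)%N].
have Bfin n : finite_set (B n).
  apply: (sub_finite_set _ (finite_II (M n).+1)) => m [_ /= mM].
  by rewrite ltnS.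
exists (block_seq B) => //; rewrite -hG; apply/seteqP; split=> x.
  move=> /(H_block_seq _ Bfin)/(_ 8^-1)[|N NP]; first by rewrite invr_gt0.
  have [|c cK xc] := M0P N x.
    move=> m [Am mM]; apply/ltW/(NP N) => //; split=> //=.
    by rewrite (leq_trans mM) // leq_maxl.
  have [i ip hic] := polarA _ _ cK.
  suff : x - c = 0 by move=> /eqP; rewrite subr_eq0 => /eqP ->; exists i.
  (* y = x - c: the block B_(k+1) improves the bound eta_k into eta_(k+1). *)
  apply: (eta_small _ N); elim=> [|k IH].
    by rewrite leqn0 => /eqP N0; rewrite N0 in xc.
  rewrite leq_eqVlt => /predU1P[<- //|]; rewrite ltnS => Nk.
  have {IH} yk := IH Nk; rewrite leNgt; apply/negP => yk1.
  have y0 : x - c != 0.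
    by apply: contraTneq yk1 => ->; rewrite circle_norm0 -leNgt ltW.
  have yL : circle_norm (x - c) * (L k.+1).+1%:R <= 4^-1.
    by apply: le_trans (etaL k); rewrite ler_wpM2r.
  have [m [Am ym]] := bohr_detects_small (LP k.+1) y0 yL.
  rewrite ltNge mulrnBl (le_trans (circle_normB _ _)) //.
  have mM : (m <= M k.+1)%N.
    rewrite leq_max; apply/orP; right; rewrite ltnW // -(ltr_nat R).
    apply: le_lt_trans (truncnS_gt _).
    rewrite invfM -ler_pdivrMr ?invr_gt0 // invrK (le_trans _ ym) //.
    by rewrite -[leRHS]mulr_natl ler_wpM2l // ltW.
  have xm : circle_norm (x *+ m) < 8^-1 by apply: (NP k.+1) => //; exact: leqW.
  have cm : circle_norm (c *+ m) <= 8^-1.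
    rewrite -hic; apply: le_trans (e8 k.+1); apply: Am.
    by rewrite (leq_trans ip) // p_mono.
  lra.
move=> [i _ <-]; apply/(H_block_seq _ Bfin) => r r0.
exists (maxn i.+1 (Num.trunc r^-1)) => n m; rewrite geq_max => /andP[ni nr] [Am _].
apply: le_lt_trans (Am i (leq_trans ni (p_ge n))) _.
rewrite /e ltr_pdivrMr ?ltr0n //.
have : r^-1 < n.+1%:R by rewrite (lt_le_trans (truncnS_gt _)) // ler_nat ltnS.
rewrite -(ltr_pM2l r0) mulfV ?gt_eqF //; lra.
Qed.

(** * Meager ideals *)

Local Open Scope nat_scope.

Lemma cylinder_nbhs (g : cantor_space) n :
  nbhs g [set f : cantor_space | forall i, i < n -> f i = g i].
Proof.
elim: n => [|n IH]; first by apply: filterS filterT => f _ i.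
have gn : nbhs g [set f : cantor_space | f n = g n].
  exact: (@proj_continuous nat (fun=> bool) n g [set g n] (discrete_set1 _)).
apply: filterS (filterI IH gn) => f [fg fn] i.
by rewrite ltnS leq_eqVlt => /predU1P[->|/fg].
Qed.

Lemma nbhs_cylinder (s : cantor_space) (U : set cantor_space) : nbhs s U ->
  exists n, forall f : cantor_space, (forall i, i < n -> f i = s i) -> U f.
Proof.
move=> sU; apply: contrapT => noU.
have /choice[f fP] n : exists f : cantor_space,
    (forall i, i < n -> f i = s i) /\ ~ U f.
  apply: contrapT => nf; apply: noU; exists n => f fs.
  by apply: contrapT => Uf; apply: nf; exists f.
have fs : {ptws, (f n @[n --> \oo]) --> (s : nat -> bool)}.
  apply/pointwise_cvgP => i V /= sV.
  by exists i.+1 => // n /= ?; rewrite (fP n).1 //; exact: nbhs_singleton.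
by have [N _ /(_ N (leqnn N))] := fs _ sU; apply: (fP N).2.
Qed.

(** Leave the closure of E inside the cylinder of g, then keep enough coordinates to
    stay out of it. *)
Lemma nowhere_dense_avoid (E : set cantor_space) (g : cantor_space) n :
  nowhere_dense E ->
  exists n', exists2 s : cantor_space, n <= n' & (forall i, i < n -> s i = g i) /\
    forall f : cantor_space, (forall i, i < n' -> f i = s i) -> ~ E f.
Proof.
move=> ndE.
have [s sg Es] : exists2 s : cantor_space,
    (forall i, i < n -> s i = g i) & ~ closure E s.
  apply: contrapT => nos.
  suff : interior (closure E) g by rewrite ndE.
  apply: filterS (cylinder_nbhs g n) => s sg.
  by apply: contrapT => Es; apply: nos; exists s.
have : nbhs s (~` closure E).
  by apply: open_nbhs_nbhs; split => //; exact/closed_openC/closed_closure.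
move=> /nbhs_cylinder[n' n'P]; exists (maxn n n'), s; first exact: leq_maxl.
split=> // f fs /(@subset_closure _ E); apply: n'P => i in'; apply: fs.
by rewrite (leq_trans in') // leq_maxr.
Qed.

(** Treat the pairs (t, E) one after the other, prolonging the same pattern s each
    time: a longer pattern still avoids the sets already treated. *)
Lemma nowhere_dense_avoid_seq (l : seq (cantor_space * set cantor_space)) n :
  (forall t E, List.In (t, E) l -> nowhere_dense E) ->
  exists n', exists2 s : cantor_space, n <= n' &
    forall t E, List.In (t, E) l -> forall f : cantor_space,
      (forall i, i < n -> f i = t i) -> (forall i, n <= i < n' -> f i = s i) ->
      ~ E f.
Proof.
elim: l => [|[t E] l IH] lnd; first by exists n, (fun=> false).
have [|n1 [s1 nn1 s1P]] := IH.
  by move=> t' E' tE; apply: (lnd t'); right.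
have [|n2 [s2 n12 [s2g s2P]]] :=
    @nowhere_dense_avoid E (fun i => if i < n then t i else s1 i) n1.
  by apply: (lnd t); left.
exists n2, s2; first exact: leq_trans n12.
move=> t' E' [[<- <-]|tE] f ft fs.
  apply: s2P => i in2; have [ni|ni] := leqP n i; first by rewrite fs // ni.
  by rewrite ft // s2g ?ni // (leq_trans ni).
apply: (s1P _ _ tE) => // i /andP[ni in1].
by rewrite fs ?ni ?(leq_trans in1) // s2g // ltnNge ni.
Qed.

(** There are only finitely many initial segments of length n, so one pattern on [n, n')
    can avoid F_0, ..., F_k after all of them at once. *)
Lemma nowhere_dense_block (F : nat -> set cantor_space) k n :
  (forall j, nowhere_dense (F j)) ->
  exists n', exists2 s : cantor_space, n < n' &
    forall j, j <= k -> forall f : cantor_space,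
      (forall i, n <= i < n' -> f i = s i) -> ~ F j f.
Proof.
move=> Fnd.
pose ext (u : {ffun 'I_n -> bool}) : cantor_space :=
  fun i => if insub i is Some o then u o else false.
pose l := List.list_prod (map ext (enum {ffun 'I_n -> bool}))
            (map F (iota 0 k.+1)).
have InP (T : eqType) (U : Type) (g : T -> U) (s : seq T) x :
    x \in s -> List.In (g x) (map g s).
  by elim: s => //= y s IH; rewrite inE => /predU1P[->|/IH]; [left|right].
have [|n' [s nn' sP]] := @nowhere_dense_avoid_seq l n.
  move=> t E /List.in_prod_iff[_]; rewrite /l.
  by elim: (iota 0 k.+1) => //= j ? IH [<-|/IH].
exists n'.+1, s => // j jk f fs; apply: (sP (ext [ffun i : 'I_n => f i]) (F j)).
- apply/List.in_prod_iff; split; apply: InP; first by rewrite mem_enum.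
  by rewrite mem_iota.
- by move=> i ni; rewrite /ext insubT /= ffunE.
- by move=> i /andP[ni /ltnW in']; rewrite fs // ni.
Qed.

(** Cut nat into consecutive intervals, the k-th one carrying a pattern that avoids
    F_0, ..., F_k whatever the other coordinates, and let phi m be the number of the
    interval of m.  If J is infinite and its preimage is in I, then so is the smaller
    set that copies the patterns of the intervals numbered in J and is empty
    elsewhere; but this set lies in no F_j. *)
Lemma meager_ideal_finite_to_one (I : set (set nat)) : meager_ideal I ->
  exists2 phi : nat -> nat, (forall k, finite_set (phi @^-1` [set k])) &
    forall J, I (phi @^-1` J) -> finite_set J.
Proof.
move=> [idI [F Fnd IF]].
have /choice[st stP] (kn : nat * nat) : exists ns : nat * cantor_space,
    kn.2 < ns.1 /\ forall j, j <= kn.1 -> forall f : cantor_space,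
      (forall i, kn.2 <= i < ns.1 -> f i = ns.2 i) -> ~ F j f.
  by have [n' [s ? ?]] := nowhere_dense_block kn.1 kn.2 Fnd; exists (n', s).
pose b := fix b k := if k is k'.+1 then (st (k', b k')).1 else 0.
have bS k : b k < b k.+1 by have [] := stP (k, b k).
have b_mono : {homo b : i j / i <= j}.
  by apply: homo_leq => //; [exact: leq_trans|move=> k; exact: ltnW].
have /choice[phi phiP] m : exists k, b k <= m < b k.+1.
  elim: m => [|m [k /andP[km mk]]]; first by exists 0; apply/andP; split; last exact: bS.
  have [mk'|mk'] := ltnP m.+1 (b k.+1); first by exists k; rewrite mk' (leqW km).
  by exists k.+1; rewrite mk' (leq_ltn_trans mk) // bS.
have phiE k m : b k <= m < b k.+1 -> phi m = k.
  move=> /andP[km mk]; have /andP[pm mp] := phiP m; apply/eqP.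
  rewrite eqn_leq; apply/andP; split; rewrite leqNgt; apply/negP => /b_mono.
    by rewrite leqNgt (leq_ltn_trans pm).
  by rewrite leqNgt (leq_ltn_trans km).
exists phi => [k|J IJ].
  apply: sub_finite_set (finite_II (b k.+1)) => m /= <-.
  by have /andP[] := phiP m.
apply: contrapT => Jinf.
pose f : cantor_space := fun m => `[< J (phi m) >] && (st (phi m, b (phi m))).2 m.
have : I [set m | f m = true].
  by apply: ideal_sub IJ => //= m /andP[/asboolP].
rewrite -[I _]/([set f : cantor_space | I [set n | f n = true]] f) IF => -[j _].
have [k Jk jk] : exists2 k, J k & j <= k.
  apply: contrapT => noJ; apply: Jinf.
  apply: sub_finite_set (finite_II j) => k Jk /=.
  by rewrite ltnNge; apply/negP => jk; apply: noJ; exists k.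
apply: (stP (k, b k)).2 => //= i ik.
by rewrite /f (phiE k i ik) asboolT.
Qed.

Local Close Scope nat_scope.

(** * Passing from Fin to a meager ideal *)

(** Since phi is finite-to-one, convergence of a_n x to 0 passes to the sequence
    a o phi in the ordinary sense: the exceptional set is empty. *)
Lemma H_sub_Hstar_comp (R : realType) (I : set (set nat)) (phi : nat -> nat) a :
  is_ideal I -> (forall k, finite_set (phi @^-1` [set k])) ->
  H_ R a Fin `<=` Hstar_ R (a \o phi) I.
Proof.
move=> idI phi_fin x xH; exists set0; first exact: ideal_fin.
apply/cvgrPdist_lt => e e0.
have /finite_set_bounded[N NP] :
    finite_set (phi @^-1` [set k | e <= circle_norm (x *~ a k - 0)]).
  rewrite (_ : phi @^-1` _ = \bigcup_(k in [set k | e <= circle_norm (x *~ a k - 0)])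
                              (phi @^-1` [set k])); last first.
    by apply/seteqP; split=> [n en|n [k ek /= phin]]; [exists (phi n)|rewrite /= phin].
  by apply: bigcup_finite => [|k _]; [exact: xH|exact: phi_fin].
exists N => // n /= Nn _; rewrite sub0r normrN ger0_norm ?circle_norm_ge0 // ltNge.
by apply/negP => /NP; rewrite ltnNge Nn.
Qed.

Lemma Hstar_sub_H (R : realType) (I : set (set nat)) a : is_ideal I ->
  Hstar_ R a I `<=` H_ R a I.
Proof.
move=> idI x [S IS /cvgrPdist_lt xS] e e0.
have [N _ NP] := xS e e0.
apply: (ideal_sub idI (B := S `|` `I_N)); last first.
  by apply: ideal_setU => //; apply: ideal_fin => //; exact: finite_II.
move=> n /= en; have [Sn|Sn] := pselect (S n); [by left|right].
rewrite /= ltnNge; apply/negP => Nn; have := NP n Nn Sn.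
by rewrite sub0r normrN ger0_norm ?circle_norm_ge0 // ltNge en.
Qed.

Lemma H_comp_sub_H (R : realType) (I : set (set nat)) (phi : nat -> nat) a :
  (forall J, I (phi @^-1` J) -> finite_set J) ->
  H_ R (a \o phi) I `<=` H_ R a Fin.
Proof. by move=> phiI x xH e e0; apply: phiI; exact: xH. Qed.

Theorem corollary2p7 (R : realType) (I : set (set nat))
    (meagerI : meager_ideal I) :
  [/\ countable_subgroups R `<=` scrH R Fin,
      scrH R Fin `<=` scrH R I `&` scrHstar R I
    & forall G : set (circle R), characterized G -> ideal_characterized I G].
Proof.
have idI := meagerI.1.
have [phi phi_fin phiI] := meager_ideal_finite_to_one meagerI.
have main : scrH R Fin `<=` scrH R I `&` scrHstar R I.
  move=> _ [a _ <-]; split; exists (a \o phi) => //; apply/seteqP; split.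
  - exact: H_comp_sub_H.
  - by apply: subset_trans (Hstar_sub_H idI); exact: H_sub_Hstar_comp.
  - by apply: subset_trans (Hstar_sub_H idI) _; exact: H_comp_sub_H.
  - exact: H_sub_Hstar_comp.
split=> // [G|G /main[]//].
exact: countable_subgroup_characterized.
Qed.
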